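(* Let $k\ge 3$ be an integer and let $F$ be a $k$-graph. If $\pi_2(F)=0$, then $F$ has a $2$-vanishing order.
   Context: A $k$-graph is a finite $k$-uniform hypergraph, with vertex set $V(F)$ and edge set $E(F)$. For a set $V$, $V^{(t)}$ denotes the collection of all $t$-subsets of $V$, and $[n]=\{1,\dots,n\}$. Degrees and degree Turán density. For a $k$-graph $H$ and $S\subseteq V(H)$ with $|S|<k$, the link $L_H(S)$ is the $(k-|S|)$-graph on $V(H)\setminus S$ with edge set $\{e\setminus S: S\subset e\in E(H)\}$; the degree of $S$ is $d_H(S)=|E(L_H(S))|$; the minimum $\ell$-degree $\delta_\ell(H)$ is the minimum of $d_H(S)$ over all $\ell$-subsets $S$ of $V(H)$. $H$ is $F$-free if it contains no copy of $F$ as a (not necessarily induced) subhypergraph. For $1\le \ell<k$ and a $k$-graph $F$, $\mathrm{ex}_\ell(n,F)$ is the maximum of $\delta_\ell(H)$ over all $n$-vertex $F$-free $k$-graphs $H$, and $\pi_\ell(F)=\lim_{n\to\infty}\mathrm{ex}_\ell(n,F)/\binom{n-\ell}{k-\ell}$ (this limit is known to exist). Vanishing orders. An ordering of a finite set $S$ is a bijection $\sigma:S\to[|S|]$. Given integers $1\le \ell\le k$ and a $k$-graph $F$, an ordering $\sigma$ of $V(F)$ is an $\ell$-vanishing order of $F$ if there is a coloring $\varphi:V(F)^{(\ell)}\to [k]^{(\ell)}$ such that for every edge $e=\{v_1,\dots,v_k\}\in E(F)$ with $\sigma(v_1)<\cdots<\sigma(v_k)$ and every $\mathcal L\in[k]^{(\ell)}$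 one has $\varphi(\{v_i:i\in\mathcal L\})=\mathcal L$. *)

(* Defs.v *)
From HB Require Import structures.
From mathcomp Require Import all_boot all_order all_algebra.
From mathcomp Require Import all_classical all_reals all_analysis.

Set Implicit Arguments.
Unset Strict Implicit.
Unset Printing Implicit Defensive.

Import Order.TTheory GRing.Theory Num.Theory.
Import numFieldNormedType.Exports.

Definition uniform (k : nat) (V : finType) (E : {set {set V}}) : bool :=
  [forall e in E, #|e| == k].

Record kgraph (k : nat) (V : finType) := KGraph {
  edges : {set {set V}};
  edges_uniform : uniform k edges }.

HB.instance Definition _ k V := [isSub for @edges k V].
HB.instance Definition _ k V := [Finite of kgraph k V by <:].

(* Edge set of L_H(S); its vertex set is V :\: S. *)
Definition link (k : nat) (V : finType) (H : kgraph k V) (S : {set V}) :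
    {set {set V}} :=
  [set e :\: S | e in edges H & S \subset e].

Definition degree (k : nat) (V : finType) (H : kgraph k V) (S : {set V}) : nat :=
  #|link H S|.

(* The default value of the minimum is the largest possible degree of an
   l-set, so it only matters when V has no l-subset. *)
Definition min_degree (l k : nat) (V : finType) (H : kgraph k V) : nat :=
  \big[minn/'C(#|V| - l, k - l)]_(S : {set V} | #|S| == l) degree H S.

Definition contains_copy (k : nat) (V W : finType)
    (F : kgraph k V) (H : kgraph k W) : bool :=
  [exists f : {ffun V -> W},
    injectiveb f && [forall e in edges F, f @: e \in edges H]].

(* n-vertex graphs are taken up to isomorphism, with vertex set 'I_n. The
   maximum is 0 if there is no F-free graph on n vertices, which happens only
   when F has no edge. *)
Definition ex (l k : nat) (V : finType) (F : kgraph k V) (n : nat) : nat :=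
  \max_(H : kgraph k 'I_n | ~~ contains_copy F H) min_degree l H.

(* pi_l(F) = a. This is a relation because [lim] takes a junk value on
   divergent sequences. *)
Definition degree_turan_density_is (R : realType) (l k : nat) (V : finType)
    (F : kgraph k V) (a : R) : Prop :=
  ((fun n : nat => (ex l F n)%:R / ('C(n - l, k - l))%:R : R)
     @ \oo --> a)%classic%R.

Definition ordering (V : finType) (sigma : V -> 'I_#|V|) : Prop :=
  bijective sigma.

(* [k] is represented by 'I_k, and a coloring V^(l) -> [k]^(l) by a map on all
   subsets of V that sends l-subsets to l-subsets. An edge is listed in
   increasing order as v 0, ..., v (k - 1). *)
Definition vanishing_order (l k : nat) (V : finType) (F : kgraph k V)
    (sigma : V -> 'I_#|V|) : Prop :=
  ordering sigma /\
  exists2 phi : {set V} -> {set 'I_k},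
    (forall A : {set V}, #|A| = l -> #|phi A| = l) &
    forall v : 'I_k -> V,
      [set v i | i : 'I_k] \in edges F ->
      (forall i j : 'I_k, i < j -> sigma (v i) < sigma (v j)) ->
      forall L : {set 'I_k}, #|L| = l -> phi [set v i | i in L] = L.

(* Main.v *)
Require Import Defs.
From HB Require Import structures.
From mathcomp Require Import all_classical all_reals all_analysis.
From mathcomp Require Import all_boot all_order all_algebra.
From mathcomp Require Import zify.

Set Implicit Arguments.
Unset Strict Implicit.
Unset Printing Implicit Defensive.

Import Order.TTheory GRing.Theory Num.Theory.

(** Write [k = m + 3]. If [F] has no 2-vanishing order, then dense [F]-free
    graphs exist, whose minimum 2-degree is a positive proportion of
    [n ^ (k - 2)].

    A vanishing order asks that the colour of a pair of vertices tell the two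
    positions that they occupy in any edge. The first attempt, a linear order
    on the vertices with a random colouring of the pairs, is dense on average
    but fails near the ends of the order: the second vertex of the order has
    only one vertex before it. So the vertices are spread over [q + 2] cells
    that form a circle, which has no ends, and [q + 2] exceeds the number of
    vertices of [F]. A copy of [F] misses a cell; cutting the circle at a missed
    cell turns it into a line, and orders the vertices of the copy. Different
    copies may use different cuts, but each of them has its order.

    The colour [(c, i, j)] of a pair names the roles [i] and [j] of its two
    vertices and a pattern [c], which gives the cells of all the roles. The
    edges are the images of the tuples [x] for which one [c] satisfies
    [col (x i) (x j) = (c, i, j)] for all [i != j]. Once the cut is known, the
    pattern tells in which order the roles appear ([cut_order]), so the colour
    of a pair tells the positions of its vertices
    ([vanishing_order_of_copy]).

    Pairs inside one cell need an edge too, and then the pattern cannot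
    separate them. This is why the roles 0 and 1 form a cluster around a
    central cell [a]: role 0 lies in [a - 1] or [a], role 1 in [a] or [a + 1],
    and role 1 is in the cell after role 0 or later in the same cell. The slack
    of one cell on each side makes every admissible pair extendable: a vertex
    of role 0 finds its partner in the next cell and a vertex of role 1 in the
    previous one ([valid_cells]), wherever they stand in their own cells.

    A random colouring has the extension property that at most [k] vertices
    with prescribed colours towards a new vertex leave a positive proportion of
    each cell to choose it from ([random_colouring]). Choosing the remaining
    [k - 2] vertices of an edge one at a time then bounds all degrees of pairs
    from below ([pair_degree_lower_bound]). *)

(** * Random families of rows *)

(** A lower tail bound by exponential moments. A family [B] of rows gets the
    weight [2 ^ (#|Z| - h)], with [h] its number of hits. The weight is a
    product over [z], so its total over all families factors, and each hit set
    of density [1 / K] saves a factor [1 - 1 / (2 * K)]; a family with few hits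
    weighs at least [2 ^ (#|Z| - s)]. *)
Lemma few_hits (X R : finType) (G : X -> {set R}) (Z : {set X}) (K s : nat) :
  (forall z, z \in Z -> #|R| <= K * #|G z|) ->
  #|[set B : {ffun X -> R} | #|[set z in Z | B z \in G z]| < s]|
    * (2 * K) ^ #|Z| <= 2 ^ s * (2 * K).-1 ^ #|Z| * #|R| ^ #|X|.
Proof.
move=> hG.
pose wt z r := if (z \in Z) && (r \notin G z) then 2 else 1.
have weight_prod (B : {ffun X -> R}) :
  2 ^ #|[set z in Z | B z \in G z]| * \prod_z wt z (B z) = 2 ^ #|Z|.
  rewrite /wt -big_mkcond /= prod_nat_const -expnD.
  rewrite -[in RHS](cardsID [set z | B z \in G z] Z); congr (2 ^ (_ + _)).
    by apply: eq_card => z; rewrite !inE.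
  by apply: eq_card => z; rewrite !inE andbC.
have weight_row z : (if z \in Z then K else 1) * \sum_r wt z r
    <= (if z \in Z then (2 * K).-1 else 1) * #|R|.
  rewrite /wt; case: ifP => hz /=; last by rewrite sum1_card.
  have -> : \sum_r (if r \notin G z then 2 else 1) = #|R| + #|~: G z|.
    rewrite (eq_bigr (fun r => 1 + (r \in ~: G z))); last first.
      by move=> r _; rewrite inE; case: (r \in G z).
    by rewrite big_split /= sum1_card -big_mkcond /= sum1_card; congr (_ + _);
      apply: eq_card => r; rewrite inE.
  have := hG z hz; rewrite -(cardsC (G z)); case: K {hG} => [//|K'] hK.
  by rewrite mulnS /= mulnDl; lia.
set bad := [set B | _].
have hbad : #|bad| * 2 ^ #|Z| <= 2 ^ s * \sum_(B : {ffun X -> R}) \prod_z wt z (B z).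
  rewrite -sum_nat_const big_distrr /= [leqRHS](bigID (mem bad)) /=.
  apply: leq_trans (leq_addr _ _); apply: leq_sum => B.
  rewrite inE => /ltnW h; rewrite -(weight_prod B) leq_mul2r.
  by rewrite leq_pexp2l ?orbT.
have hsum : K ^ #|Z| * \sum_(B : {ffun X -> R}) \prod_z wt z (B z)
    <= (2 * K).-1 ^ #|Z| * #|R| ^ #|X|.
  have powE a : \prod_z (if z \in Z then a else 1) = a ^ #|Z|.
    by rewrite -big_mkcond prod_nat_const.
  rewrite -bigA_distr_bigA -!powE /= -prod_nat_const -!big_split /=.
  exact: leq_prod.
rewrite expnMn mulnA; apply: leq_trans (leq_mul hbad (leqnn _)) _.
by rewrite -mulnA -[leqRHS]mulnA leq_mul2l [X in X <= _]mulnC hsum orbT.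
Qed.

Lemma few_hits_rare (X R : finType) (G : X -> {set R}) (Z : {set X})
    (K s r : nat) :
  (forall z, z \in Z -> #|R| <= K * #|G z|) -> 0 < K ->
  4 * (2 * K).-1 ^ r <= (2 * K) ^ r -> r * s <= #|Z| ->
  #|[set B : {ffun X -> R} | #|[set z in Z | B z \in G z]| < s]| * 2 ^ s
    <= #|R| ^ #|X|.
Proof.
move=> hG K0 hr hZ.
have := few_hits s hG; set bad := #|_|; set T := _ ^ #|X| => h.
have h4 : 4 ^ s * (2 * K).-1 ^ #|Z| <= (2 * K) ^ #|Z|.
  rewrite -(subnKC hZ) !expnD !expnM mulnA -expnMn.
  have pow_mono a b e : a <= b -> a ^ e <= b ^ e.
    by case: e => [|e] // ab; rewrite leq_exp2r.
  by apply: leq_mul; apply: pow_mono => //; apply: leq_pred.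
have K2 : 0 < (2 * K) ^ #|Z| by rewrite expn_gt0 muln_gt0 K0.
rewrite -(leq_pmul2r K2) mulnAC.
apply: leq_trans (leq_mul h (leqnn _)) _.
rewrite -[X in _ <= X]mulnC; apply: leq_trans (leq_mul h4 (leqnn T)).
by rewrite (_ : 4 = 2 * 2) // expnMn; nia.
Qed.

Lemma card_prescribed_rows (X I C : finType) (J : {set I}) (f : I -> X)
    (w : I -> C) :
  {in J &, injective f} ->
  #|[set r : {ffun X -> C} | [forall i in J, r (f i) == w i]]| * #|C| ^ #|J|
    = #|C| ^ #|X|.
Proof.
move=> finj.
pose F x := [pred v : C | [forall i in J, (f i == x) ==> (v == w i)]].
have -> : #|[set r : {ffun X -> C} | [forall i in J, r (f i) == w i]]|
    = #|family F|.
  apply: eq_card => r; rewrite inE; apply/forall_inP/familyP => h.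
    by move=> x; apply/forall_inP => i iJ; apply/implyP => /eqP <-; apply: h.
  by move=> i iJ; have /forall_inP/(_ i iJ) := h (f i); rewrite eqxx.
rewrite card_family -(card_in_imset finj) -prod_nat_const.
rewrite foldrE big_map big_enum /= [X in _ * X]big_mkcond -big_split /=.
rewrite -prod_nat_const; apply: eq_bigr => x _.
case: ifP => [/imsetP[i iJ ->]|hx].
  rewrite (eq_card (B := pred1 (w i))) ?card1 ?mul1n // => v; rewrite !inE.
  apply/forall_inP/idP => [/(_ i iJ)|/eqP-> j jJ]; first by rewrite eqxx.
  by apply/implyP => /eqP /(finj _ _ jJ iJ) ->.
rewrite muln1; apply: eq_card => v; rewrite !inE; apply/forall_inP => i iJ.
by apply/implyP => /eqP fi; rewrite -fi imset_f in hx.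
Qed.

(** Union bound over all choices of prescribed vertices and colours. The colour
    of [x, y] is [B x y + sw (B y x)], which makes reversing a pair the same as
    applying [sw], while the rows of the new vertices stay independent of the
    rows of the prescribed ones. *)
Lemma random_colouring (X I D : finType) (C : finZmodType) (sw : C -> C)
    (cell : X -> D) (s r : nat) :
  {morph sw : a b / (a + b)%R} -> involutive sw ->
  4 * (2 * #|C| ^ #|I|).-1 ^ r <= (2 * #|C| ^ #|I|) ^ r ->
  (forall d, r * s + #|I| <= #|[set x | cell x == d]|) ->
  #|X| ^ #|I| * #|C| ^ #|I| * 2 ^ #|I| * #|D| < 2 ^ s ->
  exists col : X -> X -> C,
    (forall x y, col y x = sw (col x y)) /\
    forall (J : {set I}) (f : I -> X) (w : I -> C) d, {in J &, injective f} ->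
      s <= #|[set z | [&& cell z == d, z \notin f @: J
                        & [forall i in J, col (f i) z == w i]]]|.
Proof.
move=> swD swK hr hcell hs.
pose col (B : {ffun X -> {ffun X -> C}}) x y := (B x y + sw (B y x))%R.
pose hits B (J : {set I}) (f : I -> X) (w : I -> C) d :=
  [set z | [&& cell z == d, z \notin f @: J
             & [forall i in J, col B (f i) z == w i]]].
have C0 : 0 < #|C| by apply/card_gt0P; exists 0%R.
pose Om := ({ffun I -> X} * {ffun I -> C} * {set I} * D)%type.
pose bad (o : Om) := let: (f, w, J, d) := o in
  [set B | dinjectiveb f J && (#|hits B J f w d| < s)].
have bad_rare o : #|bad o| * 2 ^ s <= #|{ffun X -> C}| ^ #|X|.
  case: o => -[[f w] J] d; rewrite /bad.
  case: (boolP (dinjectiveb f J)) => [/dinjectiveP finj|_]; last first.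
    by rewrite eq_card0 // => B; rewrite inE.
  pose S := f @: J.
  (* Adding to a row the entries of the fixed rows turns the condition on
     pairs into one on single rows. *)
  pose h (B : {ffun X -> {ffun X -> C}}) := [ffun z => [ffun x =>
    if (z \notin S) && (x \in S) then (B z x + sw (B x z))%R else B z x]].
  have hinj : injective h.
    move=> B B' /ffunP eB.
    have eBS x : x \in S -> B x = B' x.
      by move=> xS; have /ffunP := eB x => e; apply/ffunP => y;
        have := e y; rewrite !ffunE xS.
    apply/ffunP => z; apply/ffunP => x.
    have := eB z; move/ffunP/(_ x); rewrite !ffunE.
    by case: ifP => // /andP[_ xS]; rewrite (eBS x xS) => /GRing.addIr.
  pose G (z : X) := [set r : {ffun X -> C} | [forall i in J, r (f i) == sw (w i)]].
  pose Z := [set z | cell z == d] :\: S.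
  have hG z : z \in Z -> #|{ffun X -> C}| <= #|C| ^ #|I| * #|G z|.
    move=> _; rewrite card_ffun -(card_prescribed_rows (sw \o w) finj) mulnC.
    by rewrite leq_mul2r leq_pexp2l ?max_card ?orbT.
  have hZ : r * s <= #|Z|.
    have := hcell d; rewrite -(cardsID S [set x | cell x == d]) => hc.
    have : #|[set x | cell x == d] :&: S| <= #|I|.
      apply: leq_trans (subset_leq_card (subsetIr _ _)) _.
      by apply: leq_trans (leq_imset_card _ _) (max_card _).
    by move: hc; rewrite -/Z; lia.
  have K0 : 0 < #|C| ^ #|I| by rewrite expn_gt0 C0.
  apply: leq_trans (few_hits_rare hG K0 hr hZ).
  rewrite leq_mul2r -(card_imset _ hinj); apply/orP; right.
  apply/subset_leq_card/subsetP => _ /imsetP[B hB ->]; move: hB; rewrite !inE.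
  move=> /andP[_]; apply: leq_ltn_trans; apply/subset_leq_card/subsetP => z.
  rewrite !inE !ffunE => /andP[/andP[zS zd] /forall_inP e].
  rewrite zd zS /=; apply/forall_inP => i iJ; have := e i iJ.
  rewrite !ffunE zS imset_f //= /col => /eqP e'.
  by rewrite -[w i]swK -e' swD swK addrC.
have : exists B, B \notin \bigcup_o bad o.
  apply/existsP; apply: contraLR hs; rewrite negb_exists => /forallP hall.
  have covered : #|{ffun X -> C}| ^ #|X| <= \sum_o #|bad o|.
    rewrite -card_ffun; apply: leq_trans (_ : #|\bigcup_o bad o| <= _).
      by apply/subset_leq_card/subsetP => B _; have := hall B; rewrite negbK.
    elim/big_rec2: _ => [|o a b _ ab]; first by rewrite cards0.
    by apply: leq_trans (leq_card_setU _ _) _; rewrite leq_add2l.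
  have OmE : #|{: Om}| = #|X| ^ #|I| * #|C| ^ #|I| * 2 ^ #|I| * #|D|.
    by rewrite !card_prod !card_ffun -[#|{set I}|]cardsT -powersetT
      card_powerset cardsT.
  have T0 : 0 < #|{ffun X -> C}| ^ #|X|.
    by rewrite expn_gt0 card_ffun expn_gt0 C0.
  rewrite -leqNgt -OmE -(leq_pmul2l T0).
  apply: leq_trans (leq_mul covered (leqnn _)) _.
  rewrite big_distrl /= [leqRHS]mulnC -sum_nat_const.
  exact: leq_sum.
case=> B hB; exists (col B); split=> [x y|J f w d finj].
  by rewrite /col swD swK addrC.
rewrite leqNgt; apply: contra hB => few.
apply/bigcupP; exists (finfun f, finfun w, J, d) => //; rewrite inE.
apply/andP; split.
  by apply/dinjectiveP => i j iJ jJ; rewrite !ffunE; apply: finj.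
apply: leq_ltn_trans few; apply/subset_leq_card/subsetP => z; rewrite !inE.
rewrite (eq_imset (g := f)); last by move=> i; rewrite ffunE.
move=> /and3P[-> -> /forall_inP e] /=; apply/forall_inP => i iJ.
by have := e i iJ; rewrite !ffunE.
Qed.

(** * Choosing tuples one entry at a time *)

(** The entries outside [J] are set to the junk value [x0], so that the tuples
    over different [J] live in one type and can be counted there. *)
Definition partial_tuples (X I : finType) (x0 : X) (D : I -> {set X})
    (M : I -> I -> rel X) (J : {set I}) : {set {ffun I -> X}} :=
  [set x : {ffun I -> X} | [forall i, x i \in if i \in J then D i else [set x0]]
        && [forall i in J, forall j in J, (i != j) ==> M i j (x i) (x j)]].

Lemma count_extensions (X I : finType) (x0 : X) (D : I -> {set X})
    (M : I -> I -> rel X) (J0 : {set I}) (s : nat) :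
  (forall i j y z, M i j y z = M j i z y) ->
  (forall (J : {set I}) x l, J0 \subset J -> l \notin J ->
     x \in partial_tuples x0 D M J ->
     s <= #|[set z in D l | [forall i in J, M i l (x i) z]]|) ->
  0 < #|partial_tuples x0 D M J0| ->
  s ^ (#|I| - #|J0|) <= #|partial_tuples x0 D M setT|.
Proof.
move=> Msym hext h0; rewrite -cardsT.
set T := partial_tuples x0 D M.
have : J0 \subset [set: I] by apply: subsetT.
move: [set: I] => J; elim: {J}#|J| {-2}J (leqnn #|J|) => [|m IHm] J hJ sJ.
  have J00 : #|J0| = 0 by have := subset_leq_card sJ; lia.
  suff -> : J = J0 by rewrite subnn.
  by apply/eqP; rewrite eq_sym eqEcard sJ; lia.
case: (boolP (J \subset J0)) => [sJ'|/subsetPn[l lJ lJ0]].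
  suff -> : J = J0 by rewrite subnn.
  by apply/eqP; rewrite eqEsubset sJ sJ'.
pose J' := J :\ l.
have cJ : #|J| = #|J'|.+1 by rewrite (cardsD1 l J) lJ.
have sJ' : J0 \subset J' by rewrite subsetD1 sJ lJ0.
have lJ' : l \notin J' by rewrite !inE eqxx.
have {}IHm : s ^ (#|J'| - #|J0|) <= #|T J'| by apply: IHm => //; lia.
pose upd (x : {ffun I -> X}) z := [ffun i => if i == l then z else x i].
have upd_tup x z : x \in T J' -> z \in D l ->
    [forall i in J', M i l (x i) z] -> upd x z \in T J.
  rewrite !inE => /andP[/forallP xD /forall_inP xM] zD /forall_inP zM.
  apply/andP; split.
    apply/forallP => i; rewrite ffunE; case: eqP => [->|/eqP il].
      by rewrite lJ.
    by have := xD i; rewrite !inE il.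
  apply/forall_inP => i iJ; apply/forall_inP => j jJ; apply/implyP => ij.
  rewrite !ffunE; case: eqP => [il|/eqP il]; case: eqP => [jl|/eqP jl].
  - by rewrite il jl eqxx in ij.
  - by rewrite il Msym; apply: zM; rewrite !inE jl.
  - by rewrite jl; apply: zM; rewrite !inE il.
  - have iJ' : i \in J' by rewrite !inE il.
    by have /forall_inP/(_ j) := xM i iJ'; rewrite !inE jl jJ ij => /(_ isT).
have upd_res x : x \in T J -> upd x x0 \in T J'.
  rewrite !inE => /andP[/forallP xD /forall_inP xM]; apply/andP; split.
    apply/forallP => i; rewrite ffunE !inE; case: eqP => [_|/eqP il] /=.
      by rewrite inE.
    exact: xD.
  apply/forall_inP => i iJ; apply/forall_inP => j jJ; apply/implyP => ij.
  rewrite !ffunE; move: iJ jJ; rewrite !inE => /andP[/negPf-> iJ].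
  move=> /andP[/negPf-> jJ].
  by have /forall_inP/(_ j jJ) := xM i iJ; rewrite ij.
have -> : #|J| - #|J0| = (#|J'| - #|J0|).+1.
  by have := subset_leq_card sJ'; lia.
rewrite expnSr; apply: leq_trans (leq_mul IHm (leqnn s)) _.
rewrite -sum_nat_const -[leqRHS]sum1_card.
rewrite [leqRHS](partition_big (fun x => upd x x0) (mem (T J'))) /=; last first.
  exact: upd_res.
apply: leq_sum => x xT; rewrite sum1_card.
apply: leq_trans (hext J' x l sJ' lJ' xT) _.
have upd_inj : injective (upd x).
  by move=> z z' /ffunP/(_ l); rewrite !ffunE eqxx.
rewrite -(card_imset _ upd_inj); apply/subset_leq_card/subsetP.
move=> _ /imsetP[z + ->]; rewrite inE => /andP[zD zM].
rewrite unfold_in /= upd_tup //=; apply/eqP/ffunP => i; rewrite !ffunE.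
case: eqP => // ->; move: xT; rewrite inE => /andP[/forallP/(_ l)].
by rewrite (negPf lJ') inE => /eqP.
Qed.

(** * Cells on a circle and patterns *)

Definition colour (m q : nat) : Type :=
  ({ffun 'I_m.+3 -> 'I_q.+2} * 'I_m.+3 * 'I_m.+3)%type.

HB.instance Definition _ (m q : nat) := Finite.on (colour m q).
HB.instance Definition _ (m q : nat) := GRing.Zmodule.on (colour m q).

Definition swap_roles (m q : nat) (t : colour m q) : colour m q :=
  let: (c, i, j) := t in (c, j, i).

Definition around (q : nat) (a : 'I_q.+2) : seq 'I_q.+2 :=
  [:: (a - 1)%R; a; (a + 1)%R].

(** The roles 0 and 1 share the central cell [c ord0]; the other roles have
    cells of their own, at distance at least 2 from the central one, so that
    the slack of the cluster never makes it pass another role. *)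
Definition pattern (m q : nat) (c : {ffun 'I_m.+3 -> 'I_q.+2}) : bool :=
  [&& [forall i : 'I_m.+3, (i <= 1) ==> (c i == c ord0)],
      [forall i : 'I_m.+3, (1 < i) ==> (c i \notin around (c ord0))]
    & [forall i : 'I_m.+3, forall j : 'I_m.+3,
         [&& 1 < i, 1 < j & c i == c j] ==> (i == j)]].

Definition located (m q : nat) (c : {ffun 'I_m.+3 -> 'I_q.+2}) (i : 'I_m.+3)
    (d : 'I_q.+2) : bool :=
  match val i with
  | 0 => d \in [:: (c ord0 - 1)%R; c ord0]
  | 1 => d \in [:: c ord0; (c ord0 + 1)%R]
  | _ => d == c i
  end.

Definition precedes (q n : nat) (cell : 'I_n -> 'I_q.+2) (x y : 'I_n) : bool :=
  (cell y == (cell x + 1)%R) || (cell x == cell y) && (x < y).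

Definition valid (m q n : nat) (cell : 'I_n -> 'I_q.+2) (x y : 'I_n)
    (t : colour m q) : bool :=
  let: (c, i, j) := t in
  [&& pattern c, i != j, located c i (cell x), located c j (cell y),
      (val i == 0) && (val j == 1) ==> precedes cell x y
    & (val j == 0) && (val i == 1) ==> precedes cell y x].

Lemma swap_rolesK (m q : nat) : involutive (@swap_roles m q).
Proof. by case=> [[c i] j]. Qed.

Lemma swap_rolesD (m q : nat) :
  {morph @swap_roles m q : a b / (a + b)%R >-> (a + b)%R}.
Proof. by case=> [[c i] j] [[c' i'] j']. Qed.

Lemma valid_swap (m q n : nat) (cell : 'I_n -> 'I_q.+2) (x y : 'I_n)
    (t : colour m q) :
  valid cell y x (swap_roles t) = valid cell x y t.
Proof.
case: t => [[c i] j] /=; rewrite [j == i]eq_sym.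
case: (pattern c); case: (i != j) => //=.
by case: (located c i _); case: (located c j _) => //=; rewrite andbC.
Qed.

(** Listing [t] first among the cells away from [a] and giving the [l]-th cell
    of the list to role [l + 2] puts role 2 at [t]. *)
Lemma pattern_through (m q : nat) (a t : 'I_q.+2) :
  m.+2 <= q -> t \notin around a ->
  exists c : {ffun 'I_m.+3 -> 'I_q.+2},
    [/\ pattern c, c ord0 = a & forall i, val i = 2 -> c i = t].
Proof.
move=> mq ta.
pose s := t :: rem t (enum (~: [set d in around a])).
have tP : t \in enum (~: [set d in around a]) by rewrite mem_enum in_setC in_set.
have us : uniq s.
  by rewrite /= rem_uniq ?enum_uniq // mem_rem_uniq ?enum_uniq // !inE eqxx.
have sP d : d \in s -> d \notin around a.
  rewrite inE => /orP[/eqP-> //|/mem_rem].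
  by rewrite mem_enum in_setC in_set.
have szs : m < size s.
  rewrite /= size_rem // -cardE.
  have := cardsC [set d in around a]; rewrite card_ord cardsE.
  by have := card_size (around a) => /=; move: #|around a| #|~: _| => u v; lia.
pose c := [ffun i : 'I_m.+3 => if i <= 1 then a else nth a s (i - 2)].
have c_big i : 1 < val i -> c i = nth a s (i - 2) by rewrite ffunE; case: ltnP.
have i_size (i : 'I_m.+3) : 1 < i -> i - 2 < size s.
  by have := ltn_ord i; lia.
have c0 : c ord0 = a by rewrite ffunE.
exists c; split => //; last by move=> i i2; rewrite c_big i2.
apply/and3P; split.
- by apply/forallP => i; apply/implyP => i1; rewrite ffunE i1 c0.
- apply/forallP => i; apply/implyP => i1; rewrite c0 c_big //.
  by apply/sP/mem_nth/i_size.
- apply/forallP => i; apply/forallP => j; apply/implyP => /and3P[i1 j1].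
  rewrite !c_big // nth_uniq ?i_size // => /eqP e; apply/eqP/val_inj => /=.
  by move: i1 j1 e => /=; lia.
Qed.

Lemma ord_shift_neq (q : nat) (a : 'I_q.+2) :
  0 < q -> (a + 1)%R != a /\ (a + 1)%R != (a - 1)%R.
Proof.
case: q a => [//|q] a _; have one0 : (1%R : 'I_q.+3) != 0%R by [].
have two0 : (1 + 1 : 'I_q.+3)%R != 0%R by [].
split.
- by rewrite -subr_eq0 addrAC subrr add0r.
- by rewrite -subr_eq0 opprB addrC addrA subrK.
Qed.

(** Two vertices in the same cell or in neighbouring cells form the cluster of a
    pattern; two vertices further apart take the roles 0 and 2. *)
Lemma exists_valid (m q n : nat) (cell : 'I_n -> 'I_q.+2) (x y : 'I_n) :
  m.+2 <= q -> x != y -> exists t : colour m q, valid cell x y t.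
Proof.
move=> mq xy.
have lt1 : 1 < m.+3 by []. have lt2 : 2 < m.+3 by [].
pose i1 := Ordinal lt1; pose i2 := Ordinal lt2.
have close u w : precedes cell u w -> exists t : colour m q, valid cell u w t.
  move=> uw; pose a := cell u.
  have [t ta] : exists t, t \notin around a.
    apply/existsP; rewrite -negb_forall; apply/negP => /forallP all_in.
    have := max_card (mem (around a)); have := card_size (around a).
    have -> : #|around a| = q.+2.
      by rewrite -[RHS]card_ord; apply: eq_card => d; rewrite all_in.
    by move=> /=; lia.
  have [c [cP c0 _]] := pattern_through mq ta.
  exists (c, ord0, i1); rewrite /= cP /located /= c0 uw !inE eqxx orbT !andbT /=.
  have [/eqP->|/andP[/eqP<- _]] := orP uw; by rewrite eqxx ?orbT.
have [/close//|xy1] := boolP (precedes cell x y).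
have [/close[t tP]|yx1] := boolP (precedes cell y x).
  by exists (swap_roles t); rewrite valid_swap.
have far : cell y \notin around (cell x).
  rewrite /around !inE !negb_or; apply/and3P; split.
  - apply: contra yx1 => /eqP e; apply/orP; left; by rewrite e subrK.
  - apply/eqP => e; move: xy1 yx1; rewrite /precedes e eqxx /= !negb_or.
    move=> /andP[_ h1] /andP[_ h2]; case/eqP: xy; apply: val_inj => /=; lia.
  - by apply: contra xy1 => /eqP e; apply/orP; left; rewrite e.
have [c [cP c0 c2]] := pattern_through mq far.
exists (c, ord0, i2).
by rewrite /= cP /located /= c0 !inE eqxx orbT /= c2 // eqxx.
Qed.

(** Reserves a cell for every role such that any choice of vertices in these
    cells is compatible with the given pair. If the pair contains just one of
    the roles 0 and 1, the cell of the other is the neighbour on the proper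
    side of the actual cell of that vertex, not of the central cell. *)
Lemma valid_cells (m q n : nat) (cell : 'I_n -> 'I_q.+2) (x y : 'I_n)
    (c : {ffun 'I_m.+3 -> 'I_q.+2}) (i j : 'I_m.+3) :
  valid cell x y (c, i, j) ->
  exists Q : 'I_m.+3 -> 'I_q.+2,
    [/\ Q i = cell x, Q j = cell y
      & forall l l' u w, l != l' -> l' != i -> l' != j ->
          cell u = Q l -> cell w = Q l' -> valid cell u w (c, l, l')].
Proof.
move=> /= /and5P[cP ij li lj /andP[hij hji]].
pose other (l : 'I_m.+3) := match val l with
  | 0 => if val i == 1 then (cell x - 1)%R
         else if val j == 1 then (cell y - 1)%R else c ord0
  | 1 => if val i == 0 then (cell x + 1)%R
         else if val j == 0 then (cell y + 1)%R else (c ord0 + 1)%R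
  | _ => c l end.
pose Q l := if l == i then cell x else if l == j then cell y else other l.
have Qi : Q i = cell x by rewrite /Q eqxx.
have Qj : Q j = cell y by rewrite /Q eq_sym (negPf ij) eqxx.
have Qlocated l : located c l (Q l).
  rewrite /Q; case: eqP => [-> //|_]; case: eqP => [-> //|_].
  rewrite /other /located; case El: (val l) => [|[|l']] //.
  - case: eqP => [i1|_].
      move: li; rewrite /located i1 !inE => /orP[]/eqP->; first by rewrite eqxx.
      by rewrite addrK eqxx orbT.
    case: eqP => [j1|_]; last by rewrite !inE eqxx orbT.
    move: lj; rewrite /located j1 !inE => /orP[]/eqP->; first by rewrite eqxx.
    by rewrite addrK eqxx orbT.
  - case: eqP => [i1|_].
      move: li; rewrite /located i1 !inE => /orP[]/eqP->; last by rewrite eqxx orbT.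
      by rewrite subrK eqxx.
    case: eqP => [j1|_]; last by rewrite !inE eqxx orbT.
    move: lj; rewrite /located j1 !inE => /orP[]/eqP->; last by rewrite eqxx orbT.
    by rewrite subrK eqxx.
have Qnext l l' : val l = 0 -> val l' = 1 ->
    (l' != i) && (l' != j) || (l != i) && (l != j) -> Q l' = (Q l + 1)%R.
  move=> l0 l1 new.
  have n0 i' : l != i' -> (val i' == 0) = false.
    by move=> h; apply: contraNF h => /eqP h; apply/eqP/val_inj; rewrite l0.
  have n1 i' : l' != i' -> (val i' == 1) = false.
    by move=> h; apply: contraNF h => /eqP h; apply/eqP/val_inj; rewrite l1.
  rewrite /Q /other l0 l1.
  case: (eqVneq l i) new => [li'|nli]; case: (eqVneq l j) => [lj'|nlj];
    case: (eqVneq l' i) => [li''|nli']; case: (eqVneq l' j) => [lj''|nlj'] //= _;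
    rewrite -?li' -?lj' -?li'' -?lj'' ?l0 ?l1 //= ?subrK //
    ?(n0 i) ?(n0 j) ?(n1 i) ?(n1 j) ?subrK //.
exists Q; split=> // l l' u w ll' l'i l'j cu cw.
rewrite /= cP ll' cu cw !Qlocated /=; apply/andP; split; apply/implyP.
  move=> /andP[/eqP l0 /eqP l1]; apply/orP; left.
  by rewrite cu cw (Qnext l l') ?eqxx // l'i l'j.
move=> /andP[/eqP l0 /eqP l1]; apply/orP; left.
by rewrite cu cw (Qnext l' l) ?eqxx // l'i l'j orbT.
Qed.

(** * Cutting the circle *)

Definition offset (q : nat) (theta d : 'I_q.+2) : nat := val (d - theta)%R.

(** Lexicographic comparison of the distance after the cut and the vertex. *)
Definition cut_key (q n : nat) (theta : 'I_q.+2) (cell : 'I_n -> 'I_q.+2)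
    (x : 'I_n) : nat :=
  offset theta (cell x) * n + x.

Definition role_key (m q : nat) (theta : 'I_q.+2)
    (c : {ffun 'I_m.+3 -> 'I_q.+2}) (i : 'I_m.+3) : nat :=
  offset theta (c i) * 2 + (val i == 1).

Lemma offset_inj (q : nat) (theta : 'I_q.+2) : injective (offset theta).
Proof. by move=> d e /val_inj/addIr. Qed.

Lemma offset_succ (q : nat) (theta d : 'I_q.+2) :
  (d + 1)%R != theta -> offset theta (d + 1)%R = (offset theta d).+1.
Proof.
rewrite -subr_eq0 /offset -addrA [(1 - _)%R]addrC addrA.
move: (d - theta)%R => e; rewrite -(inj_eq val_inj) /= => e1.
rewrite [1 %% _]modn_small // addn1 in e1 *.
rewrite modn_small //.
have := ltn_ord e; rewrite leq_eqVlt => /orP[/eqP e2|//].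
by rewrite e2 modnn in e1.
Qed.

Lemma cut_key_inj (q n : nat) (theta : 'I_q.+2) (cell : 'I_n -> 'I_q.+2) :
  injective (cut_key theta cell).
Proof.
move=> x y e; apply: val_inj; have := congr1 (modn^~ n) e.
by rewrite /cut_key !modnMDl !modn_small.
Qed.

Lemma lex_ltn (a b u v n : nat) : u < n -> a < b -> a * n + u < b * n + v.
Proof.
move=> un ab; apply: (@leq_trans (a.+1 * n)); first by rewrite mulSn; lia.
by apply: leq_trans (leq_addr _ _); rewrite leq_mul2r ab orbT.
Qed.

(** A cut at a cell that contains no vertex of the tuple leaves the cluster in
    one piece, and then the pattern alone decides the order: the two vertices of
    the cluster are adjacent, and moving one of them to the central cell does
    not carry it past any other cell of the pattern. *)
Lemma cut_order (m q n : nat) (theta : 'I_q.+2) (cell : 'I_n -> 'I_q.+2)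
    (c : {ffun 'I_m.+3 -> 'I_q.+2}) (x : 'I_m.+3 -> 'I_n) :
  0 < q ->
  (forall i j, i != j -> valid cell (x i) (x j) (c, i, j)) ->
  (forall i, cell (x i) != theta) ->
  forall i j, cut_key theta cell (x i) < cut_key theta cell (x j) ->
    role_key theta c i < role_key theta c j.
Proof.
have step A B : A != B -> A.+1 != B -> (A < B) = (A.+1 < B) by lia.
have half A B (a b : bool) : A * 2 + a <= B * 2 + b -> A <= B by lia.
move=> q0 xc xth.
have lt1 : 1 < m.+3 by []. pose i1 : 'I_m.+3 := Ordinal lt1.
have /and5P[cP _ loc0 loc1 /andP[/implyP pre _]] := xc ord0 i1 isT.
have {}pre : precedes cell (x ord0) (x i1) by apply: pre.
have /and3P[/forallP c01 /forallP cfar /forallP cinj] := cP.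
have [s1 s3] := ord_shift_neq (c ord0) q0.
(* With the central cell empty, the roles 0 and 1 would lie in the cells before
   and after it, which are not neighbours. *)
have central : c ord0 != theta.
  apply/eqP => e; move: loc0 loc1; rewrite /located /= e !inE.
  rewrite (negPf (xth _)) (negPf (xth _)) orbF /= => /eqP e0 /eqP e1.
  move: pre; rewrite /precedes e0 e1 subrK -e (negPf s1) /=.
  by rewrite eq_sym (negPf s3).
have c0E (i : 'I_m.+3) : val i <= 1 -> c i = c ord0.
  by move=> i1'; have := c01 i; rewrite i1' => /eqP.
have cfar' (i : 'I_m.+3) : 1 < val i -> c i \notin around (c ord0).
  by move=> i1'; have := cfar i; rewrite i1'.
have locx i : located c i (cell (x i)).
  have [j ij] : exists j, i != j.
    by case: (eqVneq i ord0) => [->|h]; [exists i1|exists ord0].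
  by have /and5P[] := xc i j ij.
have cellx (i : 'I_m.+3) : 1 < val i -> cell (x i) = c i.
  by have := locx i; rewrite /located; case: (val i) => [|[|?]] // /eqP.
(* The cluster keeps its side with respect to every other cell. *)
have side (i l : 'I_m.+3) : val i <= 1 -> 1 < val l ->
    [/\ offset theta (cell (x i)) != offset theta (c l),
        (offset theta (cell (x i)) < offset theta (c l))
          = (offset theta (c ord0) < offset theta (c l))
      & offset theta (c ord0) != offset theta (c l)].
  move=> hi hl; have := cfar' l hl; rewrite /around !inE !negb_or ![c l == _]eq_sym.
  have lth : c l != theta by rewrite -(cellx l hl) xth.
  have inj a b := inj_eq (@offset_inj q theta) a b.
  case/and3P; rewrite -!(inj _ _).
  have : cell (x i) \in around (c ord0).
    have := locx i; rewrite /located /around.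
    by case: (val i) hi => [|[|?]] // _; rewrite !inE => /orP[]->; rewrite ?orbT.
  rewrite /around !inE => /or3P[] /eqP e.
  - have := @offset_succ q theta (c ord0 - 1)%R; rewrite subrK central e.
    by move=> /(_ isT) -> n1 n2 _; split; rewrite ?(step _ _ n1 n2).
  - by rewrite e; split.
  - have := @offset_succ q theta (c ord0); rewrite -e xth => /(_ isT) ->.
    by move=> _ n1 n2; split; rewrite ?(step _ _ n1 n2).
move=> i j; apply: contraLR; rewrite -!leqNgt => rji.
have [<-//|ij] := eqVneq i j; apply: ltnW; move: rji; rewrite /role_key.
case: (leqP (val i) 1) => hi; case: (leqP (val j) 1) => hj.
- rewrite !c0E // leq_add2l => bits.
  have {bits} [j0 i1'] : val j = 0 /\ val i = 1.
    have vij : val i != val j by [].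
    by move: bits vij hi hj; case: (val i) (val j) => [|[|?]] [|[|?]].
  have -> : j = ord0 by apply: val_inj.
  have -> : i = i1 by apply: val_inj.
  rewrite /cut_key; case/orP: pre => [/eqP e|/andP[/eqP -> ?]].
    by rewrite e offset_succ -?e ?xth //; apply: lex_ltn.
  by rewrite ltn_add2l.
- have [ne s _] := side i j hi hj; rewrite [c i]c0E // => /half h.
  rewrite /cut_key [cell (x j)]cellx //; apply: lex_ltn => //.
  by rewrite ltn_neqAle eq_sym ne leqNgt s -leqNgt.
- have [_ s ne] := side j i hj hi; rewrite [c j]c0E // => /half h.
  rewrite /cut_key [cell (x i)]cellx //; apply: lex_ltn => //.
  by rewrite s ltn_neqAle ne.
- have bit0 (l : 'I_m.+3) : 1 < val l -> (val l == 1) = false.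
    by case: (val l) => [|[|?]].
  rewrite !bit0 // !addn0 leq_mul2r /= leq_eqVlt => /orP[/eqP/offset_inj e|h].
    by have /forallP/(_ j) := cinj i; rewrite hi hj e eqxx (negPf ij).
  by rewrite /cut_key !cellx //; apply: lex_ltn.
Qed.

Definition rank (T : finType) (key : T -> nat) (v : T) : nat :=
  #|[set u | key u < key v]|.

Lemma rank_lt_card (T : finType) (key : T -> nat) (v : T) :
  rank key v < #|T|.
Proof.
rewrite -cardsT; apply/proper_card/properP; split; first exact: subsetT.
by exists v; rewrite ?inE ?ltnn.
Qed.

Lemma rank_mono (T : finType) (key : T -> nat) (v w : T) :
  (rank key v < rank key w) = (key v < key w).
Proof.
have mono a b : key a <= key b -> rank key a <= rank key b.
  move=> ab; apply/subset_leq_card/subsetP => u; rewrite !inE => h.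
  exact: leq_trans h ab.
apply/idP/idP => [|vw]; first by rewrite !ltnNge; apply/contra/mono.
apply/proper_card/properP; split; last by exists v; rewrite ?inE ?ltnn.
by apply/subsetP => u; rewrite !inE => /ltn_trans; apply.
Qed.

Lemma rank_increasing (T : finType) (key : T -> nat) (k : nat)
    (p : 'I_k -> T) (l : 'I_k) :
  bijective p -> (forall i j : 'I_k, i < j -> key (p i) < key (p j)) ->
  rank key (p l) = l.
Proof.
move=> pbij pinc; have pinj := bij_inj pbij; have [pinv _ pK] := pbij.
have -> : rank key (p l) = #|p @: [set i : 'I_k | i < l]|.
  apply: eq_card => u; rewrite -[u]pK inE mem_imset // inE.
  apply/idP/idP => [|/pinc//]; rewrite !ltnNge; apply: contra.
  by rewrite leq_eqVlt => /orP[/eqP/val_inj->//|/pinc/ltnW].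
rewrite card_imset //.
have wlt : l <= k by apply: ltnW.
have winj : injective (widen_ord wlt).
  by move=> i j /(congr1 val) /= /val_inj.
rewrite -[RHS]card_ord -[RHS](card_imset _ winj); apply: eq_card => i.
rewrite inE; apply/idP/imsetP => [il|[j _ ->]]; last by rewrite /= ltn_ord.
by exists (Ordinal il) => //; apply: val_inj.
Qed.

(** * The hypergraph of a colouring *)

Definition rainbow (m q n : nat) (col : 'I_n -> 'I_n -> colour m q)
    (c : {ffun 'I_m.+3 -> 'I_q.+2}) (x : {ffun 'I_m.+3 -> 'I_n}) : bool :=
  [forall i, forall j, (i != j) ==> (col (x i) (x j) == (c, i, j))].

Definition rainbow_edges (m q n : nat) (col : 'I_n -> 'I_n -> colour m q) :
    {set {set 'I_n}} :=
  [set x @: [set: 'I_m.+3] | x : {ffun 'I_m.+3 -> 'I_n}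
     & injectiveb x && [exists c, rainbow col c x]].

Lemma rainbow_edges_uniform (m q n : nat)
    (col : 'I_n -> 'I_n -> colour m q) :
  uniform m.+3 (rainbow_edges col).
Proof.
apply/forall_inP => e /imsetP[x]; rewrite inE => /andP[/injectiveP xinj _] ->.
by rewrite card_imset // cardsT card_ord.
Qed.

Definition rainbow_graph (m q n : nat) (col : 'I_n -> 'I_n -> colour m q) :
    kgraph m.+3 'I_n :=
  KGraph (rainbow_edges_uniform col).

(** The vertices of the copy are ordered along the circle from a cell [theta]
    that the copy misses. The colour [(c, i, j)] of a pair is sent to the ranks
    of [i] and [j] among the roles of [c], seen from the same cut. *)
Lemma vanishing_order_of_copy (m q n : nat) (cell : 'I_n -> 'I_q.+2)
    (col : 'I_n -> 'I_n -> colour m q) (V : finType) (F : kgraph m.+3 V) :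
  0 < q -> #|V| < q.+2 ->
  (forall x y, x != y -> valid cell x y (col x y)) ->
  contains_copy F (rainbow_graph col) ->
  exists sigma : V -> 'I_#|V|, vanishing_order 2 F sigma.
Proof.
move=> q0 Vq colv /existsP[f /andP[/injectiveP finj /forall_inP fE]].
have [theta thetaP] : exists theta, forall v, cell (f v) != theta.
  have : exists theta, theta \notin [set cell (f v) | v : V].
    apply/existsP; rewrite -negb_forall; apply/negP => /forallP all_in.
    have : #|'I_q.+2| <= #|[set cell (f v) | v : V]|.
      by apply/subset_leq_card/subsetP => d _; apply: all_in.
    have := leq_imset_card (cell \o f) V.
    rewrite card_ord => h1 h2; have := leq_trans h2 h1; by rewrite leqNgt Vq.
  case=> theta h; exists theta => v; apply: contra h => /eqP <-.
  by apply/imsetP; exists v.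
pose key v := cut_key theta cell (f v).
have keyinj : injective key by move=> u v /cut_key_inj /finj.
pose sigma v := Ordinal (rank_lt_card key v).
have sigma_lt u v : (sigma u < sigma v) = (key u < key v) by apply: rank_mono.
exists sigma; split.
  apply: inj_card_bij; last by rewrite card_ord.
  move=> u v e; apply: keyinj.
  by have [||//] := ltngtP (key u) (key v); rewrite -sigma_lt e ltnn.
pose cut_rank (t : colour m q) : 'I_m.+3 :=
  let: (c, i, _) := t in inord (rank (role_key theta c) i).
pose phi0 (A : {set V}) : {set 'I_m.+3} :=
  [set cut_rank (col (f u.1) (f u.2)) | u : V * V
     & [&& u.1 \in A, u.2 \in A & u.1 != u.2]].
(* A pair that lies in an edge does not reach the default set. *)
exists (fun A => if #|phi0 A| == 2 then phi0 A else [set ord0; ord_max]).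
  move=> A _; case: ifP => [/eqP //|_].
  by rewrite cards2.
move=> v vE vinc L cL.
have vinj : injective v.
  move=> i j e; apply: val_inj.
  by have [/vinc|/vinc|//] := ltngtP i j; rewrite e ltnn.
have /imsetP[x] := fE _ vE; rewrite inE => /andP[/injectiveP xinj].
move=> /existsP[c /forallP xc] efx.
have {}xc i j : i != j -> col (x i) (x j) = (c, i, j).
  by move=> ij; have /forallP/(_ j) := xc i; rewrite ij => /eqP.
have role_ex l : exists i, x i == f (v l).
  have : f (v l) \in x @: [set: 'I_m.+3] by rewrite -efx !imset_f.
  by case/imsetP => i _ ->; exists i.
pose p l := xchoose (role_ex l).
have xp l : x (p l) = f (v l) by apply/eqP/(xchooseP (role_ex l)).
have pinj : injective p.
  by move=> i j e; apply: vinj; apply: finj; rewrite -!xp e.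
have pbij : bijective p by apply: injF_bij.
have [pinv _ pK] := pbij.
have xtheta i : cell (x i) != theta by rewrite -[i]pK xp.
have xvalid i j : i != j -> valid cell (x i) (x j) (c, i, j).
  by move=> ij; rewrite -xc //; apply: colv; rewrite (inj_eq xinj).
have rank_p l : rank (role_key theta c) (p l) = l.
  apply: rank_increasing => // i j /vinc; rewrite sigma_lt /key -!xp => h.
  exact: (cut_order q0 xvalid xtheta).
have col_v l l' : l != l' -> cut_rank (col (f (v l)) (f (v l'))) = l.
  move=> ll'; rewrite -!xp xc ?(inj_eq pinj) //= rank_p.
  by apply: val_inj; rewrite /= inordK.
suff -> : phi0 [set v i | i in L] = L by rewrite cL eqxx.
apply/setP => l; apply/imsetP/idP => [[[u w]]|lL].
  rewrite inE /= => /and3P[/imsetP[i iL ->] /imsetP[j jL ->]].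
  by rewrite (inj_eq vinj) => ij ->; rewrite col_v.
have /card_gt0P[l'] : 0 < #|L :\ l| by move: cL; rewrite (cardsD1 l) lL; case: #|_|.
rewrite !inE => /andP[l'l l'L].
exists (v l, v l'); last by rewrite /= col_v // eq_sym.
by rewrite inE /= !imset_f // (inj_eq vinj) eq_sym l'l.
Qed.

(** The colour of [x0, x1] fixes a pattern; the other [m + 1] roles are filled
    one after the other in their reserved cells, each in at least [s] ways, and
    an edge arises from at most [k ^ k] tuples, where [k = m + 3]. *)
Lemma pair_degree_lower_bound (m q n s : nat) (cell : 'I_n -> 'I_q.+2)
    (col : 'I_n -> 'I_n -> colour m q) (x0 x1 : 'I_n) :
  (forall x y, x != y -> col y x = swap_roles (col x y)) ->
  (forall x y, x != y -> valid cell x y (col x y)) ->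
  (forall (J : {set 'I_m.+3}) (f : 'I_m.+3 -> 'I_n) (w : 'I_m.+3 -> colour m q) d,
     {in J &, injective f} ->
     s <= #|[set z | [&& cell z == d, z \notin f @: J
       & [forall i in J, valid cell (f i) z (w i) ==> (col (f i) z == w i)]]]|) ->
  x0 != x1 ->
  s ^ m.+1 <= m.+3 ^ m.+3 * degree (rainbow_graph col) [set x0; x1].
Proof.
move=> colC colv colE x01; set S := [set x0; x1].
case Ec : (col x0 x1) => [[c i] j].
have := colv _ _ x01; rewrite Ec => cv; have [Q [Qi Qj Qv]] := valid_cells cv.
have ij : i != j by case/and5P: cv.
pose D l := if l == i then [set x0] else if l == j then [set x1]
            else [set z | cell z == Q l].
pose M (l l' : 'I_m.+3) (y z : 'I_n) := (y != z) && (col y z == (c, l, l')).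
pose T := partial_tuples x0 D M.
have Msym l l' y z : M l l' y z = M l' l z y.
  rewrite /M eq_sym; case: (eqVneq z y) => //= zy.
  by rewrite (colC z y) // -(inj_eq (can_inj (@swap_rolesK m q))) swap_rolesK.
have hext (J : {set 'I_m.+3}) (x : {ffun 'I_m.+3 -> 'I_n}) l :
  [set i; j] \subset J -> l \notin J -> x \in T J ->
  s <= #|[set z in D l | [forall l' in J, M l' l (x l') z]]|.
  rewrite subUset !sub1set => /andP[iJ jJ] lJ.
  rewrite inE => /andP[/forallP xD /forall_inP xM].
  have li : l != i by apply: contraNneq lJ => ->.
  have lj : l != j by apply: contraNneq lJ => ->.
  have xinj : {in J &, injective x}.
    move=> a b aJ bJ e; apply/eqP; apply: contraT => ab.
    by have /forall_inP/(_ b bJ) := xM a aJ; rewrite ab /M e eqxx.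
  have xcell a : a \in J -> cell (x a) = Q a.
    move=> aJ; have := xD a; rewrite aJ /D; case: eqP => [->|_].
      by rewrite inE => /eqP->.
    by case: eqP => [->|_]; rewrite inE => /eqP->.
  apply: leq_trans (colE J x (fun l' => (c, l', l)) (Q l) xinj) _.
  apply/subset_leq_card/subsetP => z; rewrite !inE /D (negPf li) (negPf lj) inE.
  move=> /and3P[/eqP cz zx /forall_inP zc]; rewrite cz eqxx /=.
  apply/forall_inP => a aJ; apply/andP; split.
    by apply: contra zx => /eqP <-; apply: imset_f.
  have := zc a aJ; rewrite Qv ?xcell //.
  by apply: contraNneq lJ => <-.
have T0 : 0 < #|T [set i; j]|.
  apply/card_gt0P; exists [ffun l => if l == j then x1 else x0].
  rewrite inE; apply/andP; split.
    apply/forallP => l; rewrite ffunE !inE /D.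
    case: (eqVneq l i) => [->|li] /=; first by rewrite (negPf ij) inE.
    by case: (eqVneq l j) => _ /=; rewrite inE.
  have Mij : M i j x0 x1 by rewrite /M x01 Ec eqxx.
  apply/forall_inP => a; rewrite !inE => aij; apply/forall_inP => b.
  rewrite !inE => bij; rewrite !ffunE; apply/implyP => ab.
  case/orP: aij ab => /eqP->; case/orP: bij => /eqP->; rewrite ?eqxx ?(negPf ij) //.
  by rewrite Msym.
have := count_extensions Msym hext T0.
rewrite card_ord cards2 ij (_ : m.+3 - 2 = m.+1) ?subn2 // => /leq_trans; apply.
have TP x : x \in T setT ->
    [/\ injective x, rainbow col c x, x i = x0 & x j = x1].
  rewrite inE => /andP[/forallP xD /forall_inP xM].
  have xMP a b : a != b -> M a b (x a) (x b).
    by move=> ab; have /forall_inP/(_ b (in_setT b)) := xM a (in_setT a);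
      rewrite ab.
  split.
  - move=> a b e; apply/eqP; apply: contraT => /xMP.
    by rewrite /M e eqxx.
  - apply/forallP => a; apply/forallP => b; apply/implyP => /xMP.
    by case/andP.
  - by have := xD i; rewrite inE /D eqxx inE => /eqP.
  - by have := xD j; rewrite inE /D eqxx eq_sym (negPf ij) inE => /eqP.
pose ES := [set e in rainbow_edges col | S \subset e].
have -> : degree (rainbow_graph col) S = #|ES|.
  apply: card_in_imset => e e'; rewrite !inE => /andP[_ Se] /andP[_ Se'] h.
  by rewrite -(setID e S) -(setID e' S) h (setIidPr Se) (setIidPr Se').
rewrite mulnC -sum_nat_const -[leqLHS]sum1_card.
rewrite (partition_big (fun x : {ffun 'I_m.+3 -> 'I_n} => x @: setT)
  (mem ES)) /=; last first.
  move=> x /TP[xinj xr x0E x1E]; rewrite !inE; apply/andP; split.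
    apply/imsetP; exists x => //; rewrite inE; apply/andP; split.
      exact/injectiveP.
    by apply/existsP; exists c.
  by rewrite subUset !sub1set -x0E -x1E !imset_f.
apply: leq_sum => e; rewrite inE => /andP[eE _]; rewrite sum1_card.
have /forall_inP/(_ e eE)/eqP ce := rainbow_edges_uniform col.
have -> : m.+3 ^ m.+3 = #|(ffun_on e : {pred {ffun 'I_m.+3 -> 'I_n}})|.
  by rewrite card_ffun_on ce card_ord.
apply/subset_leq_card/subsetP => x; rewrite unfold_in /= => /andP[_ /eqP <-].
by apply/ffun_onP => a; apply: imset_f.
Qed.

(** Random colours that the cells of a pair do not allow are replaced by allowed
    ones. The extension property survives for the colours that are allowed. *)
Lemma exists_good_colouring (m q n s r : nat) (cell : 'I_n -> 'I_q.+2) :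
  m.+2 <= q ->
  let K := #|{: colour m q}| ^ m.+3 in
  4 * (2 * K).-1 ^ r <= (2 * K) ^ r ->
  (forall d, r * s + m.+3 <= #|[set x | cell x == d]|) ->
  n ^ m.+3 * K * 2 ^ m.+3 * q.+2 < 2 ^ s ->
  exists col : 'I_n -> 'I_n -> colour m q,
    [/\ forall x y, x != y -> col y x = swap_roles (col x y),
        forall x y, x != y -> valid cell x y (col x y)
      & forall (J : {set 'I_m.+3}) (f : 'I_m.+3 -> 'I_n)
          (w : 'I_m.+3 -> colour m q) d, {in J &, injective f} ->
        s <= #|[set z | [&& cell z == d, z \notin f @: J
          & [forall i in J, valid cell (f i) z (w i) ==> (col (f i) z == w i)]]]|].
Proof.
move=> mq K hr hcell hs.
have hr' : 4 * (2 * #|{: colour m q}| ^ #|'I_m.+3|).-1 ^ r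
    <= (2 * #|{: colour m q}| ^ #|'I_m.+3|) ^ r by rewrite card_ord.
have hcell' d : r * s + #|'I_m.+3| <= #|[set x | cell x == d]|.
  by rewrite card_ord.
have [|raw [rawC rawE]] :=
  random_colouring (@swap_rolesD m q) (@swap_rolesK m q) hr' hcell'.
  by rewrite !card_ord.
pose repair x y := if valid cell x y (raw x y) then raw x y
  else odflt (raw x y) [pick t | valid cell x y t].
have repair_valid x y : x != y -> valid cell x y (repair x y).
  move=> xy; rewrite /repair; case: ifP => // _; case: pickP => [t //|none].
  by have [t] := exists_valid cell mq xy; rewrite none.
pose col (x y : 'I_n) := if x < y then repair x y else swap_roles (repair y x).
exists col; split.
- move=> x y xy; rewrite /col; case: (ltngtP x y) => // [_|e].
    by rewrite swap_rolesK.
  by rewrite (val_inj e) eqxx in xy.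
- move=> x y xy; rewrite /col; case: ifP => _; first exact: repair_valid.
  by rewrite valid_swap; apply: repair_valid; rewrite eq_sym.
- move=> J f w d finj; apply: leq_trans (rawE J f w d finj) _.
  apply/subset_leq_card/subsetP => z; rewrite !inE => /and3P[-> -> /forall_inP h] /=.
  apply/forall_inP => i iJ; apply/implyP => iv; have /eqP rawi := h i iJ.
  rewrite /col /repair (rawC (f i) z) valid_swap rawi iv swap_rolesK.
  by case: ifP.
Qed.

(** * Positive degree density *)

(** Bernoulli's inequality [(1 + 1 / a) ^ r >= 1 + r / a] at [r = 3 * a]. *)
Lemma four_fold_power (a : nat) : 0 < a -> 4 * a ^ (3 * a) <= a.+1 ^ (3 * a).
Proof.
move=> a0.
have bernoulli r : (a + r) * a ^ r <= a * a.+1 ^ r.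
  elim: r => [|r IHr]; first by rewrite addn0 !expn0.
  rewrite !expnS [a * (_ * _)]mulnCA.
  apply: leq_trans (leq_mul (leqnn a.+1) IHr).
  by rewrite !mulnA leq_mul2r; apply/orP; right; nia.
by have := bernoulli (3 * a); rewrite -mulSn -!mulnA [4 * _]mulnCA leq_mul2l; lia.
Qed.

(** For [s = 2 ^ (2 * u)] the logarithm of the left side is linear in [u], and
    [s >= (u + 1) ^ 2]. *)
Lemma exp_beats_poly (A e N : nat) :
  exists s, [/\ N <= s, 0 < s & A * s ^ e < 2 ^ s].
Proof.
pose u := 2 * e + A + N; exists (2 ^ (2 * u)).
have uu : u < 2 ^ u by apply: ltn_expl.
have big : u.+1 * u.+1 <= 2 ^ (2 * u) by rewrite mul2n -addnn expnD leq_mul.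
split; [by nia | by rewrite expn_gt0 | ].
rewrite -expnM; apply: (@leq_ltn_trans (2 ^ (A + 2 * u * e))).
  by rewrite expnD leq_mul2r ltnW ?orbT // ltn_expl.
by rewrite ltn_exp2l //; apply: leq_trans big; rewrite /u; nia.
Qed.

Lemma bin_le_exp (n k : nat) : 'C(n, k) <= n ^ k.
Proof.
apply: (@leq_trans (n ^_ k)).
  by rewrite -bin_ffact leq_pmulr // fact_gt0.
elim: k n => [|k IHk] [|n] //; rewrite ffactnS expnS leq_mul2l /=.
apply: leq_trans (IHk n) _; rewrite /=.
by case: k {IHk} => // k; rewrite leq_exp2r.
Qed.

(** The cells have [r * s + k] vertices, where [r] depends on [m] and [q] only
    and makes a set of [r * s] candidates contain fewer than [s] good ones with
    probability at most [2 ^ - s]; the number of events is polynomial in [s].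
    Hence [n] is at most [b * s], and the degrees are at least
    [s ^ (k - 2) / k ^ k]. *)
Lemma dense_rainbow_graphs (m q : nat) :
  m.+2 <= q ->
  exists2 B, 0 < B & forall N0, exists n, [/\ N0 <= n, m.+3 <= n &
    exists (cell : 'I_n -> 'I_q.+2) (col : 'I_n -> 'I_n -> colour m q),
      (forall x y, x != y -> valid cell x y (col x y)) /\
      'C(n - 2, m.+3 - 2) <= B * min_degree 2 (rainbow_graph col)].
Proof.
have reorder x y z u v : x * y * z * u * v = x * v * y * z * u by lia.
move=> mq; pose K := #|{: colour m q}| ^ m.+3.
have K0 : 0 < K.
  by rewrite expn_gt0; apply/orP; left; apply/card_gt0P; exists 0%R.
pose r := 3 * (2 * K).-1.
have hr : 4 * (2 * K).-1 ^ r <= (2 * K) ^ r.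
  have a0 : 0 < (2 * K).-1 by lia.
  have h := four_fold_power a0; rewrite -/r in h; rewrite prednK in h; last by lia.
  exact: h.
pose b := q.+2 * (r + m.+3).
exists (b ^ m.+1 * m.+3 ^ m.+3); first by rewrite muln_gt0 !expn_gt0 /b; lia.
move=> N0.
have [s [sN s0 hs]] := exp_beats_poly (b ^ m.+3 * K * 2 ^ m.+3 * q.+2) m.+3 N0.
pose M := r * s + m.+3; pose n := q.+2 * M; exists n.
have r0 : 0 < r by rewrite /r; lia.
have nM : M <= n by rewrite leq_pmull.
have sM : s <= M by rewrite /M; nia.
have nb : n <= b * s by rewrite /n /b -mulnA leq_mul2l /M; nia.
split; [by lia | by rewrite /M in nM; lia | ].
pose cell (x : 'I_n) : 'I_q.+2 := inord (x %% q.+2).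
have cellM d : M <= #|[set x | cell x == d]|.
  have lt (j : 'I_M) : j * q.+2 + d < n.
    rewrite /n mulnC; have := ltn_ord j; have := ltn_ord d; nia.
  pose g j := Ordinal (lt j).
  have ginj : injective g.
    move=> i j /(congr1 val) /= /addIn /eqP; rewrite eqn_mul2r /= => /eqP.
    exact: val_inj.
  rewrite -[X in X <= _]card_ord -(card_imset _ ginj).
  apply/subset_leq_card/subsetP => _ /imsetP[j _ ->]; rewrite inE.
  by apply/eqP/val_inj; rewrite /cell /= inordK ?ltn_pmod // modnMDl modn_small.
have [|col [colC colv colE]] := exists_good_colouring mq hr cellM.
  rewrite -/K; apply: leq_ltn_trans hs.
  rewrite reorder -expnMn; do 3 (apply: leq_mul => //).
  by rewrite leq_exp2r.
exists cell, col; split => //; set C := 'C(_, _).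
have degC (S : {set 'I_n}) : #|S| == 2 ->
    C <= b ^ m.+1 * m.+3 ^ m.+3 * degree (rainbow_graph col) S.
  move=> /cards2P[x [y [xy ->]]].
  have := pair_degree_lower_bound colC colv colE xy => h.
  rewrite -mulnA; apply: leq_trans (leq_mul (leqnn _) h).
  rewrite -expnMn /C (_ : m.+3 - 2 = m.+1) ?subn2 //.
  apply: leq_trans (bin_le_exp _ _) _; rewrite leq_exp2r //.
  by rewrite -subn2; apply: leq_trans (leq_subr 2 n) nb.
rewrite /min_degree; apply: (big_ind (fun d => C <= _ * d)) => //.
- by rewrite card_ord leq_pmull // muln_gt0 !expn_gt0 /b; lia.
- by move=> d d' h h'; rewrite /minn; case: ifP.
Qed.

Theorem theorem1p4 (R : realType) (k : nat) (V : finType) (F : kgraph k V) :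
  (3 <= k)%N ->
  degree_turan_density_is 2 F (0 : R)%R ->
  exists sigma : V -> 'I_#|V|, vanishing_order 2 F sigma.
Proof.
case: k F => [|[|[|m]]] // F _ dens.
pose q := #|V| + m.+3.
have mq : m.+2 <= q by rewrite /q; lia.
have [B B0 dense] := dense_rainbow_graphs mq.
have eps0 : (0 < (B%:R^-1 : R))%R by rewrite invr_gt0 ltr0n.
have [N0 _ small] := (cvgrPdist_lt _ _).1 dens _ eps0.
have [n [N0n mn [cell [col [colv hdeg]]]]] := dense N0.
have [copy|free] := boolP (contains_copy F (rainbow_graph col)).
  by apply: (vanishing_order_of_copy _ _ colv copy); rewrite /q; lia.
exfalso; have := small n N0n; rewrite sub0r normrN ger0_norm; last first.
  by rewrite divr_ge0 ?ler0n.
apply/negP; rewrite -leNgt.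
have C0 : 0 < 'C(n - 2, m.+3 - 2) by rewrite bin_gt0; lia.
rewrite ler_pdivlMr ?ltr0n // ler_pdivrMl ?ltr0n // -natrM ler_nat.
apply: leq_trans hdeg _; rewrite leq_mul2l; apply/orP; right.
exact: (@leq_bigmax_cond _ (fun H => ~~ contains_copy F H)
  (fun H => min_degree 2 H) _ free).
Qed.
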